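(* Let $Z$ be a Banach space having a $\lambda$-EAB $(P_\alpha)_{\alpha\in\mathscr{D}}$ with $\lambda<2$. Assume that $X$ is a subspace of $Z$ that fails the weak-FPP for $\mathfrak{cm}$-nonexpansive maps. Then $X$ has a spreading model isomorphic to $\ell_1$.
   Context: A Banach space $X$ has an extended $\lambda$-approximative basis ($\lambda$-EAB), $\lambda\geq 1$, if there is a net of finite rank operators $(P_\alpha)_{\alpha\in\mathscr{D}}$ on $X$ such that $x=\lim_{\alpha\in\mathscr{D}}P_\alpha(x)$ for all $x\in X$ and $\sup_{\alpha\in\mathscr{D}}\|P_\alpha\|\leq\lambda$. Let $C$ be a bounded convex subset of a Banach space $X$. A nonexpansive map $T\colon C\to C$ is called $\mathfrak{cm}$-nonexpansive if \[ \limsup_{i\to\infty} \sup_{A\subset\{1,\dots, n\}}\Big\|\sum_{k\in A} \big(T u_{i+k} - Ty\big)\Big\|\leq \limsup_{i\to\infty} \sup_{A\subset\{1,\dots, n\}}\Big\|\sum_{k\in A} (u_{i+k} - y)\Big\| \] for all $n\in\mathbb{N}$, $y\in C$ and all sequences $(u_i)_{i=1}^\infty\subset C$. A space has the weak-FPP for $\mathfrak{cm}$-nonexpansive maps if for every weakly compact convex set $C\subset X$, every $\mathfrak{cm}$-nonexpansive map $T\colon C\to C$ has a fixed point. Spreading models (Brunel–Sucheston): a bounded sequence $(x_n)$ in $X$ generates a spreading model if there exist a subsequence $(x_{n_i})$, a seminormed space $(E,|\!|\!|\cdot|\!|\!|)$ and a sequence $(e_i)\subset E$ such that for any $n\in\mathbb{N}$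 and $\varepsilon>0$ there is $n_0$ so that for all $n_0\leq\kappa_1<\dots<\kappa_n$ and $(a_i)_{i=1}^n\in[-1,1]^n$, $\big|\,\|\sum_{i=1}^n a_i x_{\kappa_i}\| - |\!|\!|\sum_{i=1}^n a_ie_i|\!|\!|\,\big|<\varepsilon$. The space $E$ is the spreading model; it is isomorphic to $\ell_1$ when $(e_i)$ is equivalent to the unit vector basis of $\ell_1$. *)

(* Defs.v *)
From HB Require Import structures.
From mathcomp Require Import all_boot all_order all_algebra.
From mathcomp Require Import all_classical all_reals all_analysis.
Set Implicit Arguments. Unset Strict Implicit. Unset Printing Implicit Defensive.
Import Order.TTheory GRing.Theory Num.Theory.
Import numFieldNormedType.Exports.
Local Open Scope classical_set_scope.
Local Open Scope ring_scope.

Section Defs.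
Variable R : realType.

Definition directed (D : Type) (le : D -> D -> Prop) : Prop :=
  [/\ inhabited D, (forall a, le a a), (forall a b c, le a b -> le b c -> le a c)
    & (forall a b, exists c, le a c /\ le b c)].

Definition net_converges (V : normedModType R) (D : Type) (le : D -> D -> Prop)
  (x : D -> V) (l : V) : Prop :=
  forall eps : R, 0 < eps -> exists a0, forall a, le a0 a -> `|x a - l| < eps.

Definition finite_rank (V : normedModType R) (P : V -> V) : Prop :=
  exists (n : nat) (s : 'I_n -> V),
    forall x, exists c : 'I_n -> R, P x = \sum_(i < n) c i *: s i.

Definition has_EAB (Z : normedModType R) (lam : R) : Prop :=
  1 <= lam /\
  exists (D : Type) (le : D -> D -> Prop) (P : D -> {linear Z -> Z}),
    [/\ directed le,
        (forall a, finite_rank (P a)),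
        (forall x, net_converges le (fun a => P a x) x)
      & (forall a x, `|P a x| <= lam * `|x|)].

Definition functional (X : normedModType R) (f : X -> R) : Prop :=
  (forall (a : R) (x y : X), f (a *: x + y) = a * f x + f y) /\ continuous f.

Definition weakly_open (X : normedModType R) (U : set X) : Prop :=
  forall x, U x -> exists (n : nat) (f : 'I_n -> X -> R) (eps : R),
    [/\ 0 < eps, (forall i, functional (f i))
      & (forall y, (forall i, `|f i y - f i x| < eps) -> U y)].

Definition weakly_compact (X : normedModType R) (C : set X) : Prop :=
  forall (I : Type) (U : I -> set X),
    (forall i, weakly_open (U i)) ->
    (forall x, C x -> exists i, U i x) ->
    exists (m : nat) (g : 'I_m -> I), forall x, C x -> exists k, U (g k) x.

Definition convex_set (X : normedModType R) (C : set X) : Prop :=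
  forall x y (t : R), C x -> C y -> 0 <= t -> t <= 1 -> C (t *: x + (1 - t) *: y).

Definition bounded_set (X : normedModType R) (C : set X) : Prop :=
  exists M : R, forall x, C x -> `|x| <= M.

Definition cm_sup (X : normedModType R) (n : nat) (v : nat -> X) (w : X) (i : nat) : R :=
  \big[Num.max/0]_(A : {set 'I_n}) `| \sum_(k in A) (v (i + k.+1)%N - w) |.

Definition nonexpansive_on (X : normedModType R) (C : set X) (T : X -> X) : Prop :=
  forall x y, C x -> C y -> `|T x - T y| <= `|x - y|.

Definition cm_nonexpansive (X : normedModType R) (C : set X) (T : X -> X) : Prop :=
  [/\ bounded_set C, convex_set C, (forall x, C x -> C (T x)), nonexpansive_on C T
    & forall (n : nat) (y : X) (u : nat -> X), C y -> (forall i, C (u i)) ->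
        (limn_esup (fun i => (cm_sup n (fun j => T (u j)) (T y) i)%:E)
          <= limn_esup (fun i => (cm_sup n u y i)%:E))%E].

Definition weak_FPP_cm (X : normedModType R) : Prop :=
  forall C : set X, C !=set0 -> weakly_compact C -> convex_set C ->
    forall T : X -> X, cm_nonexpansive C T -> exists x, C x /\ T x = x.

Definition seminorm_on (E : lmodType R) (nrm : E -> R) : Prop :=
  [/\ (forall x, 0 <= nrm x), (forall (a : R) x, nrm (a *: x) = `|a| * nrm x)
    & (forall x y, nrm (x + y) <= nrm x + nrm y)].

Definition generates_spreading_model (X : normedModType R) (x : nat -> X)
  (phi : nat -> nat) (E : lmodType R) (nrm : E -> R) (e : nat -> E) : Prop :=
  forall (n : nat) (eps : R), 0 < eps -> exists n0 : nat,
    forall (kappa : 'I_n -> nat) (a : 'I_n -> R),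
      (forall i, (n0 <= kappa i)%N) ->
      (forall i j : 'I_n, (i < j)%N -> (kappa i < kappa j)%N) ->
      (forall i, `|a i| <= 1) ->
      `| `| \sum_(i < n) a i *: x (phi (kappa i)) | - nrm (\sum_(i < n) a i *: e i) | < eps.

Definition has_l1_spreading_model (X : normedModType R) : Prop :=
  exists (x : nat -> X) (phi : nat -> nat) (E : lmodType R) (nrm : E -> R) (e : nat -> E),
    [/\ (exists M : R, forall k, `|x k| <= M),
        (forall i j, (i < j)%N -> (phi i < phi j)%N),
        seminorm_on nrm,
        generates_spreading_model x phi nrm e
      & exists c C : R, [/\ 0 < c, 0 < C & forall (n : nat) (a : 'I_n -> R),
          c * (\sum_(i < n) `|a i|) <= nrm (\sum_(i < n) a i *: e i) /\
          nrm (\sum_(i < n) a i *: e i) <= C * (\sum_(i < n) `|a i|)]].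

End Defs.

(* Main.v *)
Require Import Defs.
From HB Require Import structures.
From mathcomp Require Import all_boot all_order all_algebra.
From mathcomp Require Import all_classical all_reals all_analysis.
From mathcomp Require Import ring lra.
Import Order.TTheory GRing.Theory Num.Theory.
Import numFieldNormedType.Exports.
Local Open Scope classical_set_scope.
Local Open Scope ring_scope.

(** Suppose [T : C -> C] is cm-nonexpansive without fixed point.  Take points
[x k] of [C] with [T (x k) - x k -> 0] and an ultrafilter [U] on the integers;
by weak compactness [x k] tends weakly along [U] to some [y] in [C].  With
[z k := x k - y], the iterated limits along [U] of
[`|x + a 0 *: z k_0 + ... + a n *: z k_n|] give the norm of a spreading model
of a subsequence of [z].  The cm-condition at [y] reads
[n `|y - T y| <= 2 `|e_0 + ... + e_(n-1)|], and [T y] differs from [y], so sums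
of basis vectors have norm of order [n].  Averaging shifts of a vector turns
this into [`|\sum_i a i e_i| >= c `|\sum_i a i|], and as [z] is weakly null,
suppressing coordinates does not increase the norm, so the estimate can be
applied to the positive and to the negative coefficients separately. *)

(** * The Hahn-Banach theorem for sublinear functionals *)

Section HahnBanach.
Context {R : realType} {V : lmodType R}.
Implicit Types (p q : V -> R) (x y : V).

Definition sublinear p : Prop :=
  (forall x y, p (x + y) <= p x + p y) /\
  (forall t x, 0 <= t -> p (t *: x) <= t * p x).

Lemma sublinear0 p : sublinear p -> p 0 = 0.
Proof.
move=> [pD pZ]; apply/eqP; rewrite eq_le.
have := pZ 0 0 (lexx _); rewrite scale0r mul0r => -> /=.
by have := pD 0 0; rewrite addr0; lra.
Qed.

Lemma sublinearZ p t x : sublinear p -> 0 <= t -> p (t *: x) = t * p x.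
Proof.
move=> pS; rewrite le_eqVlt => /predU1P[<-|t0].
  by rewrite scale0r mul0r sublinear0.
apply/eqP; rewrite eq_le pS.2 ?(ltW t0)//=.
have := pS.2 t^-1 (t *: x).
rewrite scalerA mulVf ?gt_eqF// scale1r invr_ge0 ltW// => /(_ isT).
by rewrite ler_pdivlMl.
Qed.

Lemma sublinearN p x : sublinear p -> - p (- x) <= p x.
Proof.
by move=> pS; have := pS.1 x (- x); rewrite subrr sublinear0//; lra.
Qed.

(** The witness is the infimum over [t >= 0] of [p (x + t *: y) - t * p y]; [t = 0] and [t = 1] give
    the two bounds. A minimal sublinear functional is fixed by this operation, which forces
    additivity. *)
Lemma sublinear_shift p y : sublinear p -> exists q,
  [/\ sublinear q, (forall x, q x <= p x) &
      forall x, q x <= p (x + y) - p y].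
Proof.
move=> pS; have [pD pZ] := pS.
pose S x := [set p (x + t *: y) - t * p y | t in [set t | 0 <= t]].
have Slb x : has_lbound (S x).
  exists (- p (- x)) => _ [t /= t0 <-].
  rewrite -(sublinearZ _ _ _ pS t0).
  by have := pD (x + t *: y) (- x); rewrite addrAC subrr add0r; lra.
have S0 x : S x !=set0 by exists (p (x + 0 *: y) - 0 * p y), 0 => //=.
have infS x t : 0 <= t -> inf (S x) <= p (x + t *: y) - t * p y.
  by move=> t0; apply: ge_inf => //; exists t.
exists (fun x => inf (S x)); split.
- split=> [x1 x2|t x].
    rewrite -lerBlDr; apply: lb_le_inf => // _ [t1 /= t10 <-].
    rewrite lerBlDr -lerBlDl; apply: lb_le_inf => // _ [t2 /= t20 <-].
    have := infS (x1 + x2) (t1 + t2) (addr_ge0 t10 t20).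
    have := pD (x1 + t1 *: y) (x2 + t2 *: y).
    by rewrite addrACA -scalerDl mulrDl; lra.
  rewrite le_eqVlt => /predU1P[<-|t0].
    rewrite scale0r mul0r; have := infS 0 0 (lexx _).
    by rewrite scale0r addr0 mul0r sublinear0// subr0.
  rewrite mulrC -ler_pdivrMr//; apply: lb_le_inf => // _ [s /= s0 <-].
  rewrite ler_pdivrMr//.
  have := infS (t *: x) (t * s) (mulr_ge0 (ltW t0) s0).
  by rewrite -scalerA -scalerDr (sublinearZ _ _ _ pS (ltW t0)) => /le_trans; apply; lra.
- move=> x; have := infS x 0 (lexx _).
  by rewrite scale0r addr0 mul0r subr0.
- by move=> x; have := infS x 1 ler01; rewrite scale1r mul1r.
Qed.

(** Zorn's lemma for the reversed pointwise order: a chain is bounded by its pointwise infimum,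
    finite because a member [a] below [p] satisfies [a x >= - p (- x)]. *)
Lemma minimal_sublinear p : sublinear p -> exists q,
  [/\ sublinear q, (forall x, q x <= p x) &
      forall r, sublinear r -> (forall x, r x <= q x) -> r = q].
Proof.
move=> pS.
pose P q := sublinear q /\ forall x, q x <= p x.
pose T := {q | P q}.
pose rl (s t : T) := `[< forall x, sval t x <= sval s x >].
have [||||[q [qS qp]] qmin] := @Zorn T rl.
- by move=> t; apply/asboolP.
- move=> r s t /asboolP rs /asboolP st; apply/asboolP => x.
  exact: le_trans (st x) (rs x).
- move=> [s Ps] [t Pt] /asboolP/= st /asboolP/= ts; apply: eq_exist.
  by apply/funext => x; apply/eqP; rewrite eq_le st ts.
- move=> A Atot; have [[a0 Aa0]|A0] := pselect (exists a, A a); last first.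
    exists (exist P p (conj pS (fun x => lexx (p x)))) => s As; exfalso.
    by apply: A0; exists s.
  pose S x := [set sval a x | a in A].
  have Slb x : has_lbound (S x).
    exists (- p (- x)) => _ [[a [aS ap]] /= Aa <-].
    by have := sublinearN _ x aS; have := ap (- x); lra.
  have S0 x : S x !=set0 by exists (sval a0 x), a0.
  have infS x a : A a -> inf (S x) <= sval a x.
    by move=> Aa; apply: ge_inf => //; exists a.
  have rP : P (fun x => inf (S x)).
    split; [split=> [x y|t x t0]|].
    + rewrite -lerBlDr; apply: lb_le_inf => // _ [a /= Aa <-].
      rewrite lerBlDr -lerBlDl; apply: lb_le_inf => // _ [b /= Ab <-].
      rewrite lerBlDl.
      (* The smaller of the two members bounds the infimum at [x + y], and its own subadditivity
         splits the sum. *)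
      have [/asboolP ab|/asboolP ba] := Atot _ _ Aa Ab.
        apply: (le_trans (infS _ _ Ab)).
        apply: (le_trans ((svalP b).1.1 x y)).
        by rewrite lerD2r ab.
      apply: (le_trans (infS _ _ Aa)).
      apply: (le_trans ((svalP a).1.1 x y)).
      by rewrite lerD2l ba.
    + move: t0; rewrite le_eqVlt => /predU1P[<-|t0].
        rewrite scale0r mul0r (le_trans (infS _ _ Aa0))//.
        by rewrite (sublinear0 _ (svalP a0).1).
      rewrite mulrC -ler_pdivrMr//; apply: lb_le_inf => // _ [s /= As <-].
      rewrite ler_pdivrMr// (le_trans (infS _ _ As))// mulrC.
      exact: (svalP s).1.2 _ _ (ltW t0).
    + by move=> x; rewrite (le_trans (infS _ _ Aa0))// (svalP a0).2.
  by exists (exist P _ rP) => s As; apply/asboolP => x /=; exact: infS.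
exists q; split=> // r rS rq.
have rP : P r by split=> // x; exact: le_trans (rq x) (qp x).
have := qmin (exist P r rP) (asboolT rq).
by move=> /(congr1 (fun s : T => sval s)).
Qed.

Lemma hahn_banach p v : sublinear p -> exists f : V -> R,
  [/\ (forall a x y, f (a *: x + y) = a * f x + f y),
      (forall x, f x <= p x) & f v = p v].
Proof.
move=> pS; have [p1 [p1S p1p p1v]] := sublinear_shift _ v pS.
have [q [qS qp1 qmin]] := minimal_sublinear _ p1S.
have qD x y : q (x + y) = q x + q y.
  apply/eqP; rewrite eq_le qS.1 /=.
  have [r [rS rq rv]] := sublinear_shift _ y qS.
  by have := rv x; rewrite (qmin _ rS rq); lra.
have qN x : q (- x) = - q x.
  by have := qD x (- x); rewrite subrr sublinear0//; lra.
have qZ t x : q (t *: x) = t * q x.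
  have [t0|t0] := leP 0 t; first by rewrite sublinearZ.
  rewrite -[t]opprK scaleNr -scalerN (sublinearZ _ _ _ qS) ?oppr_ge0 ?(ltW t0)// qN; lra.
exists q; split=> [a x y|x|].
- by rewrite qD qZ.
- exact: le_trans (qp1 x) (p1p x).
(* By linearity [q v = - q (- v)], so the shift bound at [- v] yields [p v <= q v]. *)
- apply/eqP; rewrite eq_le (le_trans (qp1 v) (p1p v)) /=.
  have := qp1 (- v); rewrite qN; have := p1v (- v).
  by rewrite addNr (sublinear0 _ pS); lra.
Qed.

End HahnBanach.

(** * Limits of bounded real sequences along an ultrafilter *)

Section UltrafilterLimit.
Context {R : realType} (U : set_system nat) {FU : UltraFilter U}.

(** The image ultrafilter lives on a compact segment, hence has a cluster point, and an ultrafilter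
    converges to each of its cluster points. *)
Lemma ultrafilter_cvg (f : nat -> R) (M : R) :
  (forall k, `|f k| <= M) -> cvg (f @ U).
Proof.
move=> fM.
have PF : ProperFilter (f @ U) by apply: fmap_proper_filter.
have [|p [_ pcl]] := @segment_compact R (- M) M (f @ U) PF.
  by apply: (@filterE _ U) => k; rewrite /= in_itv/= -ler_norml; exact: fM.
apply/cvg_ex; exists p => W Wp.
have [//|UW] := in_ultra_setVsetC (f @^-1` W) FU.
by have [x []] := pcl (~` W) W UW Wp.
Qed.

End UltrafilterLimit.


(** * Iterated limits of norms along the ultrafilter *)

Section IteratedNorm.
Context {R : realType} {X : normedModType R} (U : set_system nat)
  {FU : UltraFilter U}.
Variables (z : nat -> X) (M : R).
Hypothesis zM : forall k, `|z k| <= M.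
Implicit Types (a b : nat -> R) (x y : X).

(** The outermost limit belongs to the coefficient [a 0], and [x] accumulates the terms already
    chosen, so that inductions peel off limits from the front. *)
Fixpoint iter_norm n a x : R :=
  if n is m.+1 then
    lim ((fun k => iter_norm m (fun i => a i.+1) (x + a 0%N *: z k)) @ U)
  else `|x|.
Local Notation N := iter_norm.

Lemma iter_norm_bound n : forall a x,
  0 <= N n a x <= `|x| + (\sum_(i < n) `|a i|) * M.
Proof.
elim: n => [|n IHn] a x; first by rewrite /= big_ord0 mul0r addr0 lexx normr_ge0.
pose f k := N n (fun i => a i.+1) (x + a 0%N *: z k).
have fB k : 0 <= f k <= `|x| + (\sum_(i < n.+1) `|a i|) * M.
  have /andP[-> /le_trans->//] := IHn (fun i => a i.+1) (x + a 0%N *: z k).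
  rewrite big_ord_recl mulrDl addrA lerD2r (le_trans (ler_normD _ _))//.
  by rewrite lerD2l normrZ ler_wpM2l.
have fc : cvg (f @ U).
  apply: (ultrafilter_cvg U _ (`|x| + (\sum_(i < n.+1) `|a i|) * M)).
  by move=> k; have /andP[f0 f1] := fB k; rewrite ger0_norm.
apply/andP; split.
- by apply: limr_ge => //; apply: nearW => k; have /andP[] := fB k.
- by apply: limr_le => //; apply: nearW => k; have /andP[] := fB k.
Qed.

Lemma iter_norm_ge0 n a x : 0 <= N n a x.
Proof. by have /andP[] := iter_norm_bound n a x. Qed.

Lemma iter_norm_le n a x : N n a x <= `|x| + (\sum_(i < n) `|a i|) * M.
Proof. by have /andP[] := iter_norm_bound n a x. Qed.

Lemma iter_norm_cvg n a x :
  (fun k => N n (fun i => a i.+1) (x + a 0%N *: z k)) @ U --> N n.+1 a x.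
Proof.
apply: (ultrafilter_cvg U _ (`|x| + (\sum_(i < n.+1) `|a i|) * M)) => k.
rewrite ger0_norm ?iter_norm_ge0// (le_trans (iter_norm_le _ _ _))//.
rewrite big_ord_recl mulrDl addrA lerD2r (le_trans (ler_normD _ _))//.
by rewrite lerD2l normrZ ler_wpM2l.
Qed.

Lemma eq_iter_norm n : forall a b x, (forall i, (i < n)%N -> a i = b i) ->
  N n a x = N n b x.
Proof.
elim: n => [//|n IHn] a b x ab.
apply: (cvg_unique (@Rhausdorff R) (iter_norm_cvg n a x)).
rewrite (_ : (fun k => _) = (fun k => N n (fun i => b i.+1) (x + b 0%N *: z k))).
  exact: iter_norm_cvg.
by apply/funext => k; rewrite ab// (IHn _ (fun i => b i.+1))// => i ni; exact: ab.
Qed.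

Lemma iter_normD n : forall a b x y,
  N n (fun i => a i + b i) (x + y) <= N n a x + N n b y.
Proof.
elim: n => [|n IHn] a b x y; first exact: ler_normD.
apply: (ler_cvg_to (iter_norm_cvg n (fun i => a i + b i) (x + y))
  (cvgD (iter_norm_cvg n a x) (iter_norm_cvg n b y))).
apply: nearW => k; rewrite scalerDl addrACA.
exact: (IHn (fun i => a i.+1) (fun i => b i.+1)).
Qed.

Lemma iter_normZ n : forall t a x,
  N n (fun i => t * a i) (t *: x) = `|t| * N n a x.
Proof.
elim: n => [|n IHn] t a x; first exact: normrZ.
apply: (cvg_unique (@Rhausdorff R) (iter_norm_cvg n _ _)).
rewrite (_ : (fun k => _) =
  (fun k => `|t| * N n (fun i => a i.+1) (x + a 0%N *: z k))).
  by apply: cvgM; [exact: cvg_cst|exact: iter_norm_cvg].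
by apply/funext => k; rewrite -IHn scalerDr scalerA.
Qed.

Lemma iter_norm_head0 n a x : a 0%N = 0 ->
  N n.+1 a x = N n (fun i => a i.+1) x.
Proof.
move=> a0; apply: (cvg_unique (@Rhausdorff R) (iter_norm_cvg n a x)).
rewrite (_ : (fun k => _) = (fun=> N n (fun i => a i.+1) x)); first exact: cvg_cst.
by apply/funext => k; rewrite a0 scale0r addr0.
Qed.

Lemma iter_norm_tail0 n m : forall a x, (forall i, (n <= i)%N -> a i = 0) ->
  N (n + m) a x = N n a x.
Proof.
elim: n => [|n IHn] a x a0.
  elim: m a a0 => [//|m IHm] a a0.
  rewrite add0n iter_norm_head0 ?a0// -[m]add0n IHm// => i _; exact: a0.
rewrite addSn /=; congr (lim (_ @ U)); apply/funext => k.
by rewrite IHn// => i ni; exact: a0.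
Qed.

(** This modulus of continuity later carries estimates from finite nets to all vectors and
    coefficients. *)
Lemma iter_norm_lipschitz n a b x y :
  `|N n a x - N n b y| <= `|x - y| + (\sum_(i < n) `|a i - b i|) * M.
Proof.
wlog: a b x y / N n b y <= N n a x => [W|ba].
  have [/W//|/ltW/W] := leP (N n b y) (N n a x).
  by rewrite distrC [`|y - x|]distrC; under eq_bigr do rewrite distrC.
rewrite ger0_norm ?subr_ge0// lerBlDl.
have := iter_normD n b (fun i => a i - b i) y (x - y).
rewrite addrC subrK (eq_iter_norm _ _ a); last by move=> i _; rewrite addrC subrK.
by move=> /le_trans; apply; rewrite lerD2l; exact: iter_norm_le.
Qed.

Hypothesis z0 : forall f : X -> R, functional f -> (fun k => f (z k)) @ U --> (0 : R).

(* The norm [v |-> N n a (x + v)] is convex and 1-Lipschitz, hence weakly lower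
   semicontinuous. *)
Lemma iter_norm_behead n a x : N n (fun i => a i.+1) x <= N n.+1 a x.
Proof.
pose b i := a i.+1.
(* An extra real coordinate homogenizes the convex function [v |-> N n b (x + v)], which is
   recovered at second coordinate [1]. *)
pose p (w : X * R^o) := N n (fun i => w.2 * b i) (w.2 *: x + w.1).
have pS : sublinear p.
  split=> [w1 w2|t w t0]; rewrite /p /=.
    rewrite scalerDl addrACA; apply: le_trans (iter_normD n _ _ _ _).
    by rewrite (eq_iter_norm _ _ (fun i => w1.2 * b i + w2.2 * b i))// => i _;
      rewrite mulrDl.
  rewrite -[X in X * _](ger0_norm t0) -iter_normZ scalerDr scalerA.
  by rewrite (eq_iter_norm _ _ (fun i => t * (w.2 * b i)))// => i _; rewrite mulrA.
have [f [fL fp fv]] := hahn_banach p (0, 1 : R^o) pS.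
have fZ c v : f (c *: v, 0 : R^o) = c * f (v, 0 : R^o).
  have f0 : f (0, 0) = 0.
    by have := fL 1 (0, 0) (0, 0); rewrite scaler0 addr0; lra.
  have := fL c (v, 0) (0, 0); rewrite f0 !addr0 => <-.
  by congr f; rewrite -[RHS]/(c *: v, c *: (0 : R^o)) scaler0.
have fn v : f (v, 0 : R^o) <= `|v|.
  apply: le_trans (fp _) _; rewrite /p /= scale0r add0r.
  rewrite (eq_iter_norm _ _ (fun=> 0)); last by move=> i _; rewrite mul0r.
  by rewrite -[n]add0n iter_norm_tail0.
have ff : functional (fun v => f (v, 0 : R^o)).
  have fM c v w : f (c *: v + w, 0 : R^o) = c * f (v, 0 : R^o) + f (w, 0 : R^o).
    rewrite -fL; congr f.
    by rewrite -[RHS]/(c *: v + w, c *: (0 : R^o) + 0) scaler0 addr0.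
  split=> // v; apply/cvgrPdist_lt => e e0.
  near=> w.
  have fB u : `|f (u, 0 : R^o)| <= `|u|.
    rewrite ler_norml fn andbT lerNl -[X in X <= _]mulN1r -fZ scaleN1r.
    by rewrite (le_trans (fn _))// normrN.
  have -> : f (v, 0 : R^o) - f (w, 0 : R^o) = f (v - w, 0 : R^o).
    by rewrite [v - w]addrC -[- w]scaleN1r fM mulN1r addrC.
  apply: le_lt_trans (fB _) _.
  near: w; exact: cvgr_dist_lt.
(* A supporting affine function at [x]; for [c = a 0] and [v = z k] its linear term tends to [0]
   along [U]. *)
have fb c v : c * f (v, 0 : R^o) + N n b x <= N n b (x + c *: v).
  have -> : N n b x = f (0, 1 : R^o).
    rewrite fv /p /= scale1r addr0; apply: eq_iter_norm => i _.
    by rewrite mul1r.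
  rewrite -fL; apply: le_trans (fp _) _; rewrite /p /=.
  rewrite scaler0 add0r scale1r addr0 le_eqVlt; apply/orP; left; apply/eqP.
  by apply: eq_iter_norm => i _; rewrite mul1r.
have := ler_cvg_to (cvgD (cvgM (cvg_cst (a 0%N)) (z0 _ ff)) (cvg_cst (N n b x)))
  (iter_norm_cvg n a x).
rewrite mulr0 add0r; apply; apply: nearW => k; exact: fb.
Unshelve. all: by end_near. Qed.

(** A coordinate that is kept passes through the limit; one that is set to zero is removed by
    [iter_norm_behead]. *)
Lemma iter_norm_suppress n : forall a b x, (forall i, (i < n)%N -> b i = a i \/ b i = 0) ->
  N n b x <= N n a x.
Proof.
elim: n => [//|n IHn] a b x ab.
have abS i : (i < n)%N -> b i.+1 = a i.+1 \/ b i.+1 = 0 by exact: (ab i.+1).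
have [b0|b0] := ab 0%N (ltn0Sn n).
  apply: (ler_cvg_to (iter_norm_cvg n b x) (iter_norm_cvg n a x)).
  by apply: nearW => k; rewrite b0; exact: IHn.
rewrite iter_norm_head0//; apply: le_trans (iter_norm_behead n a x).
exact: IHn.
Qed.

End IteratedNorm.


(** * Coefficients of finite combinations of monomials *)

Section PolyCoef.
Context {R : realType}.

Lemma coef_sum_monomial n (a : 'I_n -> R) j :
  (\sum_(i < n) a i *: 'X^i : {poly R})`_j = oapp a 0 (insub j).
Proof.
rewrite coef_sum; case: insubP => [i _ ij|]/=.
  rewrite (bigD1 i)//= coefZ coefXn ij eqxx mulr1 big1 ?addr0// => k ki.
  rewrite coefZ coefXn -ij; case: eqP => [e|_]; last by rewrite mulr0.
  by case/eqP: ki; exact/val_inj.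
rewrite -leqNgt => nj; apply: big1 => i _; rewrite coefZ coefXn.
by rewrite gtn_eqF ?mulr0// (leq_trans _ nj).
Qed.

Lemma horner1_sum_monomial n (a : 'I_n -> R) :
  (\sum_(i < n) a i *: 'X^i : {poly R}).[1] = \sum_(i < n) a i.
Proof.
by rewrite horner_sum; apply: eq_bigr => i _; rewrite hornerZ hornerXn expr1n mulr1.
Qed.

End PolyCoef.

(** * The spreading norm and its two-sided [l1] estimate *)

Section SpreadingNorm.
Context {R : realType} {X : normedModType R} (U : set_system nat)
  {FU : UltraFilter U}.
Variables (z : nat -> X) (M : R).
Hypothesis zM : forall k, `|z k| <= M.
Implicit Types p q : {poly R}.

(** Polynomials encode finitely supported sequences, ['X^i] being the basis vector [e_i]:
    multiplication by ['X] is the shift and [p.[1]] the sum of the coordinates. *)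
Definition spreading_norm p : R := iter_norm U z (size p) (fun i => p`_i) 0.
Local Notation nrm := spreading_norm.

Lemma spreading_normE p n : (size p <= n)%N ->
  nrm p = iter_norm U z n (fun i => p`_i) 0.
Proof.
move=> pn; rewrite -(subnKC pn) (iter_norm_tail0 U z _ zM)//.
by move=> i; exact: nth_default.
Qed.

Lemma spreading_norm_seminorm : seminorm_on nrm.
Proof.
split=> [p|c p|p q]; first exact: iter_norm_ge0 zM _ _ _.
- rewrite (spreading_normE _ (size p)) ?size_scale_leq// -(iter_normZ U z _ zM) scaler0.
  by apply: (eq_iter_norm U z _ zM) => i _; rewrite coefZ.
- pose n := maxn (size p) (size q).
  rewrite !(spreading_normE _ n) ?leq_maxl ?leq_maxr ?size_polyD//.
  rewrite -[X in iter_norm _ _ _ _ X]addr0.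
  apply: le_trans (iter_normD U z _ zM n _ _ _ _).
  by rewrite (eq_iter_norm U z _ zM _ _ (fun i => p`_i + q`_i))// => i _; rewrite coefD.
Qed.

Lemma spreading_norm_mulX p : nrm (p * 'X) = nrm p.
Proof.
rewrite (spreading_normE _ (size p).+1); last first.
  by rewrite (leq_trans (size_polyMleq _ _))// size_polyX addn2.
rewrite (iter_norm_head0 U z _ zM) ?coefMX//.
by apply: (eq_iter_norm U z _ zM) => i _; rewrite coefMX.
Qed.

Lemma spreading_norm_mulXn p n : nrm (p * 'X^n) = nrm p.
Proof.
elim: n => [|n IHn]; first by rewrite expr0 mulr1.
by rewrite exprSr mulrA spreading_norm_mulX.
Qed.

Lemma spreading_norm_le n (a : 'I_n -> R) :
  nrm (\sum_(i < n) a i *: 'X^i) <= M * \sum_(i < n) `|a i|.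
Proof.
rewrite (spreading_normE _ n); last first.
  apply/leq_sizeP => j nj; rewrite coef_sum_monomial insubF//.
  by rewrite ltnNge nj.
rewrite (le_trans (iter_norm_le U z _ zM _ _ _))// normr0 add0r mulrC.
rewrite le_eqVlt; apply/orP; left; apply/eqP; congr (_ * _).
by apply: eq_bigr => i _; rewrite coef_sum_monomial valK.
Qed.

(* Multiplying by [\sum_(s < S) 'X^s] averages the shifts of [p], which all
   have the same norm; it turns [p] into [p.[1] *: \sum_(s < S) 'X^s] up to the
   bounded error [q * ('X^S - 1)]. *)
Lemma spreading_norm_horner1 c :
  (forall n, c * n%:R <= nrm (\sum_(i < n) 'X^i)) ->
  forall p, c * `|p.[1]| <= nrm p.
Proof.
move=> cn p; have [nrm0 nrmZ nrmD] := spreading_norm_seminorm.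
have /factor_theorem[q pq] : root (p - p.[1]%:P) 1.
  by rewrite /root !hornerE subrr.
have nrmN r : nrm (- r) = nrm r by rewrite -scaleN1r nrmZ normrN1 mul1r.
have pS S : nrm (p * \sum_(i < S) 'X^i) <= S%:R * nrm p.
  elim: S => [|S IHS].
    by rewrite big_ord0 mulr0 -[X in nrm X](scale0r p) nrmZ normr0 mul0r.
  rewrite big_ord_recr /= mulrDr (le_trans (nrmD _ _))// spreading_norm_mulXn.
  by rewrite -natr1 mulrDl mul1r lerD2r.
have key S : S%:R * (c * `|p.[1]| - nrm p) <= 2 * nrm q.
  have e : p.[1] *: \sum_(i < S) 'X^i = p * (\sum_(i < S) 'X^i) + (- (q * 'X^S) + q).
    have -> : - (q * 'X^S) + q = - (q * ('X^S - 1)) by ring.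
    rewrite subrX1 mulrA -pq -mul_polyC; ring.
  have h1 := ler_wpM2l (normr_ge0 p.[1]) (cn S).
  have h2 := nrmD (p * (\sum_(i < S) 'X^i)) (- (q * 'X^S) + q).
  have := nrmD (- (q * 'X^S)) q; rewrite nrmN spreading_norm_mulXn => h3.
  move: h2; rewrite -e nrmZ => h2; have := pS S; lra.
(* If the claim failed, [key] would bound all integers [S], against the Archimedean property. *)
rewrite leNgt; apply/negP => lt_p.
have d0 : 0 < c * `|p.[1]| - nrm p by rewrite subr_gt0.
have := archi_boundP (divr_ge0 (mulr_ge0 (ler0n R 2) (nrm0 q)) (ltW d0)).
by rewrite ltr_pdivrMr// => /lt_le_trans/(_ (key _)); rewrite ltxx.
Qed.

Hypothesis z0 : forall f : X -> R, functional f -> (fun k => f (z k)) @ U --> (0 : R).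

Lemma spreading_norm_suppress p q :
  (forall i, q`_i = p`_i \/ q`_i = 0) -> nrm q <= nrm p.
Proof.
move=> pq; pose n := maxn (size p) (size q).
rewrite !(spreading_normE _ n) ?leq_maxl ?leq_maxr//.
exact: (iter_norm_suppress U z _ zM z0).
Qed.

Lemma spreading_norm_ge c :
  (forall n, c * n%:R <= nrm (\sum_(i < n) 'X^i)) ->
  forall n (a : 'I_n -> R),
  c / 2 * \sum_(i < n) `|a i| <= nrm (\sum_(i < n) a i *: 'X^i).
Proof.
move=> cn n a.
(* Used with [h] the positive and the negative part; adding the two estimates accounts for the
   factor [1 / 2]. *)
have part (h : R -> R) : (forall x, h x = x \/ h x = 0) ->
    c * `|\sum_(i < n) h (a i)| <= nrm (\sum_(i < n) a i *: 'X^i).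
  move=> hP; rewrite -(horner1_sum_monomial n (fun i => h (a i))).
  apply: le_trans (spreading_norm_horner1 c cn _) _.
  apply: spreading_norm_suppress => j; rewrite !coef_sum_monomial.
  by case: insubP => [i _ _|_] /=; [exact: hP|left].
have pos := part (fun x => Num.max x 0) _.
have neg := part (fun x => Num.min x 0) _.
have -> : \sum_(i < n) `|a i| =
    `|\sum_(i < n) Num.max (a i) 0| + `|\sum_(i < n) Num.min (a i) 0|.
  rewrite ger0_norm ?ler0_norm ?sumr_ge0 ?sumr_le0//; last 2 first.
  - by move=> i _; rewrite ge_min lexx orbT.
  - by move=> i _; rewrite le_max lexx orbT.
  rewrite -sumrN -big_split/=; apply: eq_bigr => i _.
  by have [a0|a0] := leP 0 (a i); [rewrite ger0_norm|rewrite ltr0_norm]; lra.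
have {}pos := pos _; have {}neg := neg _.
rewrite -mulrA [_^-1 * _]mulrC mulrA ler_pdivrMr// mulrDr.
have {pos neg}[] : _ /\ _ := conj (pos _) (neg _).
- by move=> x; rewrite maxEle; case: ifP => _; [right|left].
- by move=> x; rewrite minEle; case: ifP => _; [left|right].
- lra.
Qed.

End SpreadingNorm.


(** * Finite nets of coefficients *)

Lemma near_seq {T : eqType} {I : Type} (F : set_system I) {FF : Filter F}
    (s : seq T) (P : T -> I -> Prop) :
  (forall x, x \in s -> \forall k \near F, P x k) ->
  \forall k \near F, forall x, x \in s -> P x k.
Proof.
elim: s => [|y s IHs] sP; first by apply: nearW.
have yP := sP y (mem_head y s).
have sP' : \forall k \near F, forall x, x \in s -> P x k.
  by apply: IHs => x xs; apply: sP; rewrite inE xs orbT.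
by apply: filterS2 yP sP' => k Py Ps x; rewrite inE => /orP[/eqP->//|]; exact: Ps.
Qed.

Lemma unit_interval_net {R : realType} (d : R) : 0 < d -> exists s : seq R,
  forall a, `|a| <= 1 -> exists2 b, b \in s & `|a - b| <= d.
Proof.
(* The grid starts at [-1] with mesh [d]; since [a + 1 <= 2], the integer part of [(a + 1) / d] is
   below [K]. *)
move=> d0; pose K := (Num.truncn (2 / d)).+1.
exists [seq i%:R * d - 1 | i <- iota 0 K] => a; rewrite ler_norml => /andP[a1 a2].
have ad0 : 0 <= (a + 1) / d by rewrite divr_ge0 ?(ltW d0)//; lra.
exists ((Num.truncn ((a + 1) / d))%:R * d - 1).
  apply/mapP; exists (Num.truncn ((a + 1) / d)) => //.
  rewrite mem_iota /= add0n ltnS; apply: le_truncn.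
  by rewrite ler_pM2r ?invr_gt0//; lra.
have /andP[] := truncn_itv ad0.
by rewrite ler_pdivlMr// ltr_pdivrMr// -natr1 mulrDl mul1r ler_norml; lra.
Qed.

Lemma coef_net {R : realType} n (d : R) : 0 < d -> exists s : seq (nat -> R),
  forall a : nat -> R, (forall i, `|a i| <= 1) ->
  exists2 b, b \in s & \sum_(i < n) `|a i - b i| <= d.
Proof.
elim: n d => [|n IHn] d d0.
  by exists [:: fun=> 0] => a _; exists (fun=> 0); rewrite ?mem_head// big_ord0 ltW.
have d2 : 0 < d / 2 by rewrite divr_gt0.
have [s sP] := IHn _ d2; have [t tP] := unit_interval_net _ d2.
pose f (c : R) (b : nat -> R) i := if i is j.+1 then b j else c.
exists [seq f c b | c <- t, b <- s] => a a1.
have [b bs ab] := sP (fun i => a i.+1) (fun i => a1 i.+1).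
have [c ct ac] := tP (a 0%N) (a1 0%N).
exists (f c b); first by apply/allpairsP; exists (c, b).
by rewrite big_ord_recl /=; move: ab ac; lra.
Qed.

(** * Extraction of a subsequence generating the spreading norm *)

Section Subsequence.
Context {R : realType} {X : normedModType R} (U : set_system nat)
  {FU : UltraFilter U}.
Variables (z : nat -> X) (M : R).
Hypothesis zM : forall k, `|z k| <= M.
Local Notation N := (iter_norm U z).

(** The vectors [x] that can have accumulated once the indices of [h] are available; their total
    boundedness makes the convergence along [U] uniform. *)
Fixpoint unit_combinations (h : seq nat) : set X :=
  if h is k :: h' then
    [set v | exists x a, [/\ unit_combinations h' x, `|a| <= 1 & v = x + a *: z k]]
  else [set 0].

Lemma unit_combinations_net h (d : R) : 0 < d -> exists s : seq X,
  forall x, unit_combinations h x -> exists2 y, y \in s & `|x - y| <= d.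
Proof.
elim: h d => [|k h IHh] d d0.
  by exists [:: 0] => x ->; exists 0; rewrite ?mem_head// subrr normr0 ltW.
have d2 : 0 < d / 2 by rewrite divr_gt0.
have M0 : 0 <= M by exact: le_trans (zM k).
have M1 : 0 < M + 1 by lra.
have [s sP] := IHh _ d2.
(* Dividing by [M + 1] covers the case [M = 0]. *)
have [t tP] := unit_interval_net _ (divr_gt0 d2 M1).
exists [seq x + a *: z k | x <- s, a <- t] => _ [x [a [hx a1 ->]]].
have [y ys xy] := sP x hx; have [b bt ab] := tP a a1.
exists (y + b *: z k); first by apply/allpairsP; exists (y, b).
rewrite opprD addrACA -scalerBl (le_trans (ler_normD _ _))// normrZ.
rewrite [leRHS]splitr lerD//; move: ab; rewrite ler_pdivlMr// => ab.
apply: le_trans ab; rewrite ler_wpM2l//.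
by rewrite (le_trans (zM k)) // lerDl.
Qed.

(** Convergence holds simultaneously at the finitely many net points, and Lipschitz bounds
    independent of [k] extend it to all [x] and [a]. *)
Lemma iter_norm_near h n (d : R) : 0 < d ->
  \forall k \near U, forall x a, unit_combinations h x -> (forall i, `|a i| <= 1) ->
    `|N n.+1 a x - N n (fun i => a i.+1) (x + a 0%N *: z k)| <= d.
Proof.
move=> d0; have M0 : 0 <= M by exact: le_trans (zM 0%N).
(* Vectors and coefficients each cost [d / 6] in each of the two norms, and convergence at the net
   points costs [d / 3]. *)
have d6 : 0 < d / 6 by rewrite divr_gt0.
have M1 : 0 < M + 1 by lra.
have [s sP] := unit_combinations_net h (d / 6) d6.
have [t tP] := coef_net n.+1 (d / 6 / (M + 1)) (divr_gt0 d6 M1).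
have st : \forall k \near U, forall p : X * (nat -> R),
    p \in [seq (x, a) | x <- s, a <- t] ->
    `|N n.+1 p.2 p.1 - N n (fun i => p.2 i.+1) (p.1 + p.2 0%N *: z k)| <= d / 3.
  apply: near_seq => -[x a] _ /=.
  have /cvgrPdist_le := iter_norm_cvg U (FU := FU) z _ zM n a x; apply.
  by rewrite divr_gt0.
apply: filterS st => k st x a hx a1.
have [y ys xy] := sP x hx; have [b bt ab] := tP a a1.
have {}ab : (\sum_(i < n.+1) `|a i - b i|) * M <= d / 6.
  move: ab; rewrite ler_pdivlMr//; apply: le_trans.
  by rewrite ler_wpM2l ?sumr_ge0// lerDl.
have st' : `|N n.+1 b y - N n (fun i => b i.+1) (y + b 0%N *: z k)| <= d / 3.
  apply: (st (y, b)).
  by apply/allpairsP; exists (y, b).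
have h1 := iter_norm_lipschitz U (FU := FU) z _ zM n.+1 a b x y.
have h2 := iter_norm_lipschitz U (FU := FU) z _ zM n (fun i => a i.+1) (fun i => b i.+1)
  (x + a 0%N *: z k) (y + b 0%N *: z k).
have h3 : `|x + a 0%N *: z k - (y + b 0%N *: z k)| <= `|x - y| + `|a 0%N - b 0%N| * M.
  rewrite opprD addrACA -scalerBl (le_trans (ler_normD _ _))// normrZ lerD2l.
  by rewrite ler_wpM2l.
have e : \sum_(i < n.+1) `|a i - b i| =
    `|a 0%N - b 0%N| + \sum_(i < n) `|a i.+1 - b i.+1| by rewrite big_ord_recl.
rewrite e mulrDl in h1 ab; cbv beta in h2.
have t1 := ler_distD (N n.+1 b y) (N n.+1 a x)
  (N n (fun i => a i.+1) (x + a 0%N *: z k)).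
have t2 := ler_distD (N n (fun i => b i.+1) (y + b 0%N *: z k)) (N n.+1 b y)
  (N n (fun i => a i.+1) (x + a 0%N *: z k)).
rewrite distrC in h2; apply: (le_trans t1); lra.
Qed.

Hypothesis Uoo : \oo `<=` U.

Lemma spreading_step h : exists k, (forall i, i \in h -> (i < k)%N) /\
  forall n, (n <= size h)%N -> forall x a, unit_combinations h x ->
    (forall i, `|a i| <= 1) ->
    `|N n.+1 a x - N n (fun i => a i.+1) (x + a 0%N *: z k)| <= 2 ^- (size h).+1.
Proof.
have h1 : \forall k \near U, forall i, i \in h -> (i < k)%N.
  by apply: near_seq => i _; apply: Uoo; exact: nbhs_infty_gt.
have h2 : \forall k \near U, forall n, n \in iota 0 (size h).+1 ->
    forall x a, unit_combinations h x -> (forall i, `|a i| <= 1) ->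
    `|N n.+1 a x - N n (fun i => a i.+1) (x + a 0%N *: z k)| <= 2 ^- (size h).+1.
  by apply: near_seq => n _; apply: iter_norm_near; rewrite invr_gt0 exprn_gt0.
have [k [hk1 hk2]] := filter_ex (filterI h1 h2).
by exists k; split=> // n nh; apply: hk2; rewrite mem_iota /= add0n ltnS.
Qed.

(** The limits are replaced by actual indices one at a time, outermost first; [n <= r] keeps the
    number of remaining coefficients in the range of [spreading_step]. *)
Lemma spreading_subsequence : exists phi : nat -> nat,
  (forall i j, (i < j)%N -> (phi i < phi j)%N) /\
  forall n r (kappa : nat -> nat) (a : nat -> R), (n <= r)%N ->
    (forall i, (i < n)%N -> (r <= kappa i)%N) ->
    (forall i j, (i < j < n)%N -> (kappa i < kappa j)%N) ->
    (forall i, `|a i| <= 1) ->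
    `|N n a 0 - `|\sum_(i < n) a i *: z (phi (kappa i))| | <= 2 ^- r.
Proof.
have [next nextP] := choice spreading_step.
(* [hist r] holds the [r] indices chosen so far, so the tolerance in choosing [phi r] is
   [2 ^- r.+1]. *)
pose hist := fix hist r := if r is s.+1 then next (hist s) :: hist s else [::].
pose phi r := next (hist r).
have size_hist r : size (hist r) = r by elim: r => //= r ->.
have mem_hist i r : (i < r)%N -> phi i \in hist r.
  elim: r => // r IHr; rewrite ltnS leq_eqVlt inE => /predU1P[->|/IHr->].
    by rewrite eqxx.
  by rewrite orbT.
(* Skipped indices enter with coefficient [0]. *)
have comb_mono r s x : (r <= s)%N ->
    unit_combinations (hist r) x -> unit_combinations (hist s) x.
  move=> /subnKC <-; elim: (s - r)%N => [|m IHm]; first by rewrite addn0.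
  by rewrite addnS => /IHm hx; exists x, 0; rewrite normr0 scale0r addr0.
exists phi; split=> [i j ij|].
  by have [jP _] := nextP (hist j); apply: jP; exact: mem_hist.
have main n : forall r kappa a x, (n <= r)%N ->
    (forall i, (i < n)%N -> (r <= kappa i)%N) ->
    (forall i j, (i < j < n)%N -> (kappa i < kappa j)%N) ->
    (forall i, `|a i| <= 1) -> unit_combinations (hist r) x ->
    `|N n a x - `|x + \sum_(i < n) a i *: z (phi (kappa i))| | <= 2 ^- r.
  elim: n => [|n IHn] r kappa a x nr rk kk a1 hx.
    by rewrite big_ord0 addr0 subrr normr0 invr_ge0 exprn_ge0.
  set k := kappa 0%N; have rk0 : (r <= k)%N by exact: rk.
  have hkx : unit_combinations (hist k) x by exact: comb_mono hx.
  have [_ /(_ n)] := nextP (hist k); rewrite size_hist -/(phi k).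
  move=> /(_ (leq_trans (ltnW nr) rk0) x a hkx a1) st.
  have := IHn k.+1 (fun i => kappa i.+1) (fun i => a i.+1) (x + a 0%N *: z (phi k)).
  rewrite big_ord_recl -/k addrA => IH.
  have {}IH := IH (leq_trans (ltnW nr) (leqW rk0)) (fun i ni => kk 0%N i.+1 ni)
    (fun i j ij => kk i.+1 j.+1 ij) (fun i => a1 i.+1)
    (ex_intro _ x (ex_intro _ (a 0%N) (And3 hkx (a1 0%N) erefl))).
  (* Replacing the first limit costs [2 ^- k.+1], and all later ones, starting from history [k.+1],
     cost as much together. *)
  have e : 2 ^- k.+1 + 2 ^- k.+1 = 2 ^- k :> R.
    by rewrite exprS invfM -mulrDl (_ : 2^-1 + 2^-1 = 1) ?mul1r//; lra.
  have kr : 2 ^- k <= 2 ^- r :> R.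
    by rewrite lef_pV2 ?posrE ?exprn_gt0//; apply: ler_weXn2l; rewrite ?ler1n.
  apply: le_trans kr; rewrite -e; apply: le_trans (lerD st IH).
  exact: ler_distD.
move=> n r kappa a nr rk kk a1.
have := main n r kappa a 0 nr rk kk a1 (comb_mono 0%N r 0 (leq0n r) erefl).
by rewrite add0r.
Qed.

End Subsequence.


(** * Approximate fixed points of nonexpansive maps *)

Section ApproximateFixedPoints.
Context {R : realType} {X : normedModType R}.
Variables (C : set X) (T : X -> X).
Hypotheses (C0 : C !=set0) (Cbnd : Defs.bounded_set C) (Ccvx : Defs.convex_set C)
  (TC : forall x, C x -> C (T x)) (Tne : nonexpansive_on C T).

Lemma approximate_fixed_point (e : R) : 0 < e ->
  exists x, C x /\ `|T x - x| <= e.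
Proof.
move=> e0; have [w Cw] := C0; have [M0 CM0] := Cbnd.
pose M := `|M0| + 1.
have M_gt0 : 0 < M by rewrite ltr_wpDl.
have CM x : C x -> `|x| <= M.
  by move=> /CM0 /le_trans; apply; rewrite (le_trans (ler_norm _))// lerDl.
have CM2 x y : C x -> C y -> `|x - y| <= 2 * M.
  move=> Cx Cy; rewrite (le_trans (ler_normB _ _))//.
  by have := CM x Cx; have := CM y Cy; lra.
(* Distances in [C] are at most [2 * M], so moving a point the fraction [d] of the way to [w]
   displaces it by at most [e / 2]. *)
pose d := e / (e + 4 * M).
have eM : 0 < e + 4 * M by lra.
have d0 : 0 < d by rewrite divr_gt0.
have d1 : d < 1 by rewrite ltr_pdivrMr// mul1r; lra.
have dM : d * (2 * M) <= e / 2.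
  by rewrite /d mulrAC ler_pdivrMr//; nra.
(* Iterates of the contraction [S] are nearly fixed, which dispenses with its
   fixed point and with completeness. *)
pose S x := (1 - d) *: T x + (1 - (1 - d)) *: w.
have SC x : C x -> C (S x) by move=> Cx; apply: Ccvx => //; [exact: TC|lra|lra].
have ST x y : C x -> C y -> `|S x - S y| <= (1 - d) * `|x - y|.
  move=> Cx Cy; rewrite /S; set b := 1 - (1 - d); rewrite opprD addrACA subrr addr0 -scalerBr normrZ.
  by rewrite ger0_norm ?ler_wpM2l ?Tne//; lra.
pose x k := iter k S w.
have Cx k : C (x k) by elim: k => //= k; exact: SC.
have xS k : `|S (x k) - x k| <= (1 - d) ^+ k * (2 * M).
  elim: k => [|k IHk]; first by rewrite expr0 mul1r CM2//; exact: SC.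
  apply: (le_trans (ST (x k.+1) (x k) (Cx _) (Cx _))).
  by rewrite exprS -mulrA ler_wpM2l//; lra.
have : (fun k => (1 - d) ^+ k * (2 * M)) @ \oo --> (0 : R).
  rewrite -(mul0r (2 * M)); apply: cvgM; last exact: cvg_cst.
  by apply: cvg_expr; rewrite ger0_norm; lra.
move=> /cvgrPdist_le/(_ _ (divr_gt0 e0 (ltr0Sn R 1))) [k _ /(_ k (leqnn k))] /= kP.
exists (x k); split=> //.
have {}kP : `|S (x k) - x k| <= e / 2.
  apply: le_trans (xS k) _; apply: le_trans kP.
  by rewrite sub0r normrN ler_norm.
have TS : `|T (x k) - S (x k)| <= e / 2.
  have -> : T (x k) - S (x k) = d *: (T (x k) - w).
    have dE : 1 - (1 - d) = d by lra.
    rewrite /S dE scalerBl scale1r opprD opprB scalerBr addrA.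
    by rewrite [T (x k) + _]addrC subrK.
  rewrite normrZ gtr0_norm//; apply: le_trans dM; rewrite ler_wpM2l ?(ltW d0)//.
  by apply: CM2 => //; exact: TC.
by rewrite (le_trans (ler_distD (S (x k)) _ _))//; lra.
Qed.

End ApproximateFixedPoints.

(** * Weak limits along the ultrafilter, and comparison of upper limits *)

Section WeakUltrafilterLimit.
Context {R : realType} {X : normedModType R} (U : set_system nat)
  {FU : UltraFilter U}.

Lemma weakly_open_functional (f : X -> R) (y : X) (e : R) :
  functional f -> weakly_open [set v | `|f y - f v| < e].
Proof.
move=> ff x /= xe; exists 1%N, (fun=> f), (e - `|f y - f x|); split=> //.
  by rewrite subr_gt0.
move=> v /(_ ord0) vx; apply: le_lt_trans (ler_distD (f x) _ _) _.
by rewrite -ltrBrDl distrC.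
Qed.

(** Otherwise each point of [C] has a weakly open neighbourhood avoided by [u] along [U]; finitely
    many cover [C], and some [u k] avoids them all. *)
Lemma weakly_compact_ultralimit (C : set X) (u : nat -> X) :
  weakly_compact C -> (forall k, C (u k)) ->
  exists2 y, C y & forall f : X -> R, functional f -> f (u k) @[k --> U] --> f y.
Proof.
move=> Cc Cu.
have [y Cy yU] : exists2 y, C y &
    forall V, weakly_open V -> V y -> \forall k \near U, V (u k).
  apply: contrapT => noy.
  pose I := {V : set X | weakly_open V /\ \forall k \near U, ~ V (u k)}.
  have [||m [g gC]] := Cc I (fun V => sval V).
  - by move=> i; have [] := svalP i.
  - move=> x Cx; apply: contrapT => nV; apply: noy; exists x => // V Vo Vx.
    have [//|nVU] := in_ultra_setVsetC (u @^-1` V) FU.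
    by exfalso; apply: nV; exists (exist _ V (conj Vo nVU)).
  have : \forall k \near U, forall i, i \in enum 'I_m -> ~ sval (g i) (u k).
    by apply: near_seq => i _; have [] := svalP (g i).
  move=> /filter_ex[k kP]; have [i] := gC _ (Cu k).
  by apply: kP; rewrite mem_enum.
exists y => // f ff; apply/cvgrPdist_lt => e e0.
apply: (yU [set v | `|f y - f v| < e]); first exact: weakly_open_functional.
by rewrite /= subrr normr0.
Qed.

End WeakUltrafilterLimit.

(** An upper limit is the infimum, over sets of the filter, of suprema: each such set meets the one
    where [A <= a k], and the one where [b k <= B] is itself admissible. *)
Lemma le_limn_esup_bounds {R : realType} (a b : nat -> R) (A B : R) :
  (limn_esup (EFin \o a) <= limn_esup (EFin \o b))%E ->
  (\forall k \near \oo, A <= a k) -> (\forall k \near \oo, b k <= B) -> A <= B.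
Proof.
move=> ab aA bB; rewrite -lee_fin.
apply: (@le_trans _ _ (limn_esup (EFin \o a))).
  rewrite /limn_esup limf_esupE; apply: le_ereal_inf_tmp => _ [V Voo <-].
  have [k [Vk Ak]] := filter_ex (filterI Voo aA).
  by apply: le_trans (ereal_sup_ubound _); last (exists k; [exact: Vk|reflexivity]);
    rewrite lee_fin.
apply: le_trans ab _; rewrite /limn_esup limf_esupE.
apply: ge_ereal_inf; exists (ereal_sup ((EFin \o b) @` [set k | b k <= B])).
  by exists [set k | b k <= B].
by apply: ge_ereal_sup => _ [k /= kB <-]; rewrite lee_fin.
Qed.

(** * From a map without fixed points to an [l1] spreading model *)

Section FixedPoint.
Context {R : realType} {X : normedModType R}.

Lemma cm_nonexpansive_l1_spreading_model (C : set X) (T : X -> X) :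
  C !=set0 -> weakly_compact C -> cm_nonexpansive C T ->
  (forall x, C x -> T x <> x) -> has_l1_spreading_model X.
Proof.
move=> C0 Cc [Cb Ccvx TC Tne Tcm] nofix.
have [U [FU Uoo]] := ultraFilterLemma (eventually_filter : ProperFilter \oo).
have /choice[x xP] : forall k : nat, exists x, C x /\ `|T x - x| <= k.+1%:R^-1.
  by move=> k; apply: (approximate_fixed_point C T C0 Cb Ccvx TC Tne);
    rewrite invr_gt0.
have Cx k : C (x k) by have [] := xP k.
have [y Cy xy] := weakly_compact_ultralimit U C x Cc Cx.
pose z k := x k - y.
have [M M0 zM] : exists2 M, 0 < M & forall k, `|z k| <= M.
  have [B CB] := Cb; exists (`|B + B| + 1); first by rewrite ltr_wpDl.
  move=> k; rewrite (le_trans (ler_normB _ _))//.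
  rewrite (le_trans (lerD (CB _ (Cx k)) (CB _ Cy)))//.
  by rewrite (le_trans (ler_norm _))// lerDl.
have z0 f : functional f -> f (z k) @[k --> U] --> (0 : R).
  move=> ff; have -> : (fun k => f (z k)) = (fun k => f (x k) - f y).
    apply/funext => k; rewrite /z -[- y]scaleN1r addrC ff.1; lra.
  by rewrite -(subrr (f y)); apply: cvgB; [exact: xy|exact: cvg_cst].
have [phi [phiS phiP]] := spreading_subsequence U z M zM Uoo.
have phi_ge k : (k <= phi k)%N.
  by elim: k => // k IHk; rewrite (leq_ltn_trans IHk)// phiS.
pose nrm := spreading_norm U z.
have gen : generates_spreading_model z phi nrm (fun i => 'X^i).
  move=> n e e0.
  have [r nr re] : exists2 r, (n <= r)%N & 2 ^- r < e.
    have [r0 _ r0P] := near_infty_natSinv_expn_lt (PosNum e0).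
    exists (maxn n r0); first exact: leq_maxl.
    by have := r0P (maxn n r0) (leq_maxr _ _); rewrite /= div1r.
  exists r => kappa a rk kk a1.
  (* Both families are extended from ['I_n] to the integers by the default [0]; only indices below
     [n] matter. *)
  have := phiP n r (fun i => oapp kappa 0%N (insub i)) (fun i => oapp a 0 (insub i)) nr.
  rewrite -(eq_iter_norm U z M zM n (fun i => (\sum_(i < n) a i *: 'X^i)`_i)); last first.
    by move=> i _; rewrite coef_sum_monomial.
  rewrite -(spreading_normE U z M zM); last first.
    apply/leq_sizeP => j nj; rewrite coef_sum_monomial insubF//.
    by rewrite ltnNge nj.
  have -> : \sum_(i < n) oapp a 0 (insub (i : nat)) *:
        z (phi (oapp kappa 0%N (insub (i : nat)))) =
      \sum_(i < n) a i *: z (phi (kappa i)).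
    by apply: eq_bigr => i _; rewrite !valK.
  move=> H; rewrite distrC; apply: le_lt_trans re; apply: H.
  - by move=> i ni; rewrite insubT /=; exact: rk.
  - move=> i j /andP[ij jn]; have ni := ltn_trans ij jn.
    by rewrite !insubT /=; apply: kk.
  - by move=> i; case: insubP => [j _ _|_]/=; rewrite ?normr0.
have lower n : `|y - T y| / 2 * n%:R <= nrm (\sum_(i < n) 'X^i).
  set S := nrm _; apply/ler_addgt0Pr => e e0.
  have e2 : 0 < e / 2 by rewrite divr_gt0.
  have [n0 n0P] := gen n _ e2.
  have sumA i (A : {set 'I_n}) : (n0 <= i)%N ->
      `|\sum_(k in A) (x (phi (i + k.+1)%N) - y)| <= S + e / 2.
    move=> n0i; pose a (k : 'I_n) : R := (k \in A)%:R.
    have := n0P (fun k => (i + k.+1)%N) a.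
    have -> : \sum_(k in A) (x (phi (i + k.+1)%N) - y) =
        \sum_(k < n) a k *: z (phi (i + k.+1)%N).
      rewrite big_mkcond; apply: eq_bigr => k _; rewrite /a.
      by case: ifP => _; rewrite ?scale1r ?scale0r.
    (* Indicator coefficients arise from constant ones by suppression, so a single bound serves all
       [A]. *)
    have aS : nrm (\sum_(k < n) a k *: 'X^k) <= S.
      have -> : S = nrm (\sum_(k < n) 1 *: 'X^k).
        by congr nrm; apply: eq_bigr => k _; rewrite scale1r.
      apply: (spreading_norm_suppress U z M zM z0) => j; rewrite !coef_sum_monomial.
      by case: insubP => [k _ _|_]/=; [rewrite /a; case: (k \in A); [left|right]|left].
    move=> /(_ (fun k => leq_trans n0i (leq_addr _ _))).
    have mono (k l : 'I_n) : (k < l)%N -> (i + k.+1 < i + l.+1)%N.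
      by rewrite ltn_add2l ltnS.
    have a1 k : `|a k| <= 1 by rewrite /a; case: (k \in A); rewrite ?normr1 ?normr0.
    move=> /(_ mono a1); rewrite ltr_norml => /andP[_]; lra.
  have bound := Tcm n y (fun i => x (phi i)) Cy (fun i => Cx (phi i)).
  (* After halving, the total error is [3 / 4 * e], within the allowed [e]. *)
  have : n%:R * `|y - T y| - (S + e / 2) - e / 2 <= S + e / 2.
    pose A0 : {set 'I_n} := finset.setTfor 'I_n.
    apply: (le_limn_esup_bounds _ _ _ _ bound).
    (* Beyond [n1], the [n] displacements [T x - x] add up to at most [e / 2]. *)
    - pose n1 := Num.truncn (n%:R / (e / 2)).
      near=> i; rewrite /cm_sup.
      pose F (A : {set 'I_n}) := `|\sum_(k in A) (T (x (phi (i + k.+1)%N)) - T y)|.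
      apply: le_trans (le_bigmax 0 F A0); rewrite /F.
      have -> : \sum_(k in A0) (T (x (phi (i + k.+1)%N)) - T y) =
          \sum_(k in A0) (y - T y)
          + \sum_(k in A0) (x (phi (i + k.+1)%N) - y)
          + \sum_(k in A0) (T (x (phi (i + k.+1)%N)) - x (phi (i + k.+1)%N)).
        rewrite -!big_split; apply: eq_bigr => k _ /=.
        by rewrite [RHS]addrC [y - _ + _]addrC !addrA !subrK.
      have h1 : `|\sum_(k in A0) (y - T y)| = n%:R * `|y - T y|.
        by rewrite sumr_const /A0 finset.cardsT card_ord normrMn mulr_natl.
      have h2 : `|\sum_(k in A0) (x (phi (i + k.+1)%N) - y)| <= S + e / 2.
        by apply: sumA; near: i; exact: nbhs_infty_ge.
      have h3 : `|\sum_(k in A0)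
          (T (x (phi (i + k.+1)%N)) - x (phi (i + k.+1)%N))| <= e / 2.
        rewrite (le_trans (ler_norm_sum _ _ _))//.
        have n1i : (n1 <= i)%N by near: i; exact: nbhs_infty_ge.
        have hk (k : 'I_n) : k \in A0 ->
            `|T (x (phi (i + k.+1)%N)) - x (phi (i + k.+1)%N)| <= n1.+1%:R^-1.
          move=> _; have [_ /le_trans] := xP (phi (i + k.+1)%N); apply.
          rewrite lef_pV2 ?posrE ?ltr0Sn// ler_nat ltnS.
          exact: leq_trans n1i (leq_trans (leq_addr _ _) (phi_ge _)).
        rewrite (le_trans (ler_sum _ hk))// sumr_const /A0 finset.cardsT card_ord -[leLHS]mulr_natl.
        rewrite ler_pdivrMr ?ltr0Sn// mulrC -ler_pdivrMr//.
        by apply: ltW; rewrite truncnS_gt.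
      set s1 := \sum_(k in _) (y - T y) in h1 *.
      set s2 := \sum_(k in _) (x _ - y) in h2 *.
      set s3 := \sum_(k in _) (T _ - _) in h3 *.
      have := ler_normB (s1 + (s2 + s3)) (s2 + s3).
      rewrite addrK addrA h1 => H; have := ler_normD s2 s3; lra.
    - near=> i; apply: bigmax_le => [|A _].
        apply: addr_ge0; last exact: ltW.
        by have [nrm0 _ _] := spreading_norm_seminorm U z M zM; exact: nrm0.
      by apply: sumA; near: i; exact: nbhs_infty_ge.
  lra.
exists z, phi, {poly R}, nrm, (fun i => 'X^i); split=> //.
- by exists M.
- exact: (spreading_norm_seminorm U (FU := FU) z M zM).
(* One factor [1 / 2] comes from the cm-condition, the other from splitting by signs. *)
- exists (`|y - T y| / 2 / 2), M; split=> //.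
    rewrite !divr_gt0// normr_gt0 subr_eq0; apply/eqP => yT.
    exact: nofix Cy (esym yT).
  move=> n a; split; first exact: (spreading_norm_ge U z M zM z0).
  exact: (spreading_norm_le U z M zM).
Unshelve. all: by end_near. Qed.

End FixedPoint.

Theorem mainTheorem1 (R : realType) (Z : completeNormedModType R) (lam : R)
  (hZ : has_EAB Z lam) (hlam : lam < 2)
  (X : completeNormedModType R) (J : {linear X -> Z})
  (hJ : forall x : X, `|J x| = `|x|)
  (hX : ~ weak_FPP_cm X) :
  has_l1_spreading_model X.
Proof.
apply: contrapT => noX; apply: hX => C C0 Cc _ T Tcm.
apply: contrapT => nofix; apply: noX.
apply: (cm_nonexpansive_l1_spreading_model C T C0 Cc Tcm) => x Cx Txx.
by apply: nofix; exists x.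
Qed.
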